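(* For every $n\geq 2$, there is no perfect pair state transfer in the complementary prism $K_n\overline{K_n}$ of the complete graph $K_n$ with respect to the adjacency matrix.
   Context: The complementary prism $G\overline{G}$ of a graph $G$ is obtained from the disjoint union of $G$ and its complement $\overline{G}$ (vertices relabelled $a'$ for $a\in V(G)$) by adding an edge between each vertex $a$ of $G$ and its copy $a'$ in $\overline{G}$. For a real symmetric matrix $M$ associated with a graph (here its adjacency matrix), $U_M(t)=\exp(itM)$. There is perfect state transfer between two linearly independent real unit vectors $\mathbf{u},\mathbf{v}$ with respect to $M$ if there exist $\tau>0$ and $\gamma\in\mathbb{C}$ with $|\gamma|=1$ such that $U_M(\tau)\mathbf{u}=\gamma\mathbf{v}$. A pair state is a vector $\frac{1}{\sqrt2}(\mathbf{e}_x-\mathbf{e}_y)$ with $x\ne y$ vertices of the graph, where $\mathbf{e}_x$ is the characteristic vector of $x$. Perfect pair state transfer is perfect state transfer between two pair states. *)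

(* Defs.v *)
From HB Require Import structures.
From mathcomp Require Import all_boot all_order all_algebra.
From mathcomp Require Import complex.
From mathcomp Require Import all_classical all_reals all_analysis.

Set Implicit Arguments.
Unset Strict Implicit.
Unset Printing Implicit Defensive.

Import Order.TTheory GRing.Theory Num.Theory.
Import numFieldNormedType.Exports.

Local Open Scope ring_scope.
Local Open Scope classical_set_scope.

Record sgraph (V : finType) := SGraph {
  adj :> rel V;
  adj_sym : symmetric adj;
  adj_irr : irreflexive adj }.

Section Graphs.
Variable V : finType.

Lemma complete_sym : symmetric [rel x y : V | x != y].
Proof. by move=> x y /=; rewrite eq_sym. Qed.

Lemma complete_irr : irreflexive [rel x y : V | x != y].
Proof. by move=> x /=; rewrite eqxx. Qed.

Definition complete_graph : sgraph V := SGraph complete_sym complete_irr.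

Variable G : sgraph V.

Lemma compl_sym : symmetric [rel x y : V | (x != y) && ~~ G x y].
Proof. by move=> x y /=; rewrite eq_sym (adj_sym G). Qed.

Lemma compl_irr : irreflexive [rel x y : V | (x != y) && ~~ G x y].
Proof. by move=> x /=; rewrite eqxx. Qed.

Definition compl_graph : sgraph V := SGraph compl_sym compl_irr.

(* [inl a] is the vertex a of G and [inr a] its copy a' in the complement. *)
Definition compl_prism_rel : rel (V + V) := fun x y =>
  match x, y with
  | inl a, inl b => G a b
  | inr a, inr b => compl_graph a b
  | inl a, inr b | inr a, inl b => a == b
  end.

Lemma compl_prism_sym : symmetric compl_prism_rel.
Proof.
by case=> a [] b /=;
  [exact: adj_sym | exact: eq_sym | exact: eq_sym | exact: compl_sym].
Qed.

Lemma compl_prism_irr : irreflexive compl_prism_rel.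
Proof. by case=> a; [exact: adj_irr | exact: compl_irr]. Qed.

Definition compl_prism : sgraph (V + V)%type :=
  SGraph compl_prism_sym compl_prism_irr.

End Graphs.

(* Rows and columns follow the enumeration [enum V] of the vertices. *)
Definition adjmx (R : realType) (V : finType) (G : sgraph V) : 'M[R]_#|V| :=
  \matrix_(i, j) (G (enum_val i) (enum_val j))%:R.

Definition charvec (R : realType) (V : finType) (x : V) : 'cV[R]_#|V| :=
  delta_mx (enum_rank x) 0.

Definition pair_state (R : realType) (V : finType) (x y : V) : 'cV[R]_#|V| :=
  (Num.sqrt 2)^-1 *: (charvec R x - charvec R y).

Definition expmx (K : numFieldType) (n : nat) (A : 'M[K]_n) : 'M[K]_n :=
  limn (series (fun k => (k`!%:R)^-1 *: A ^+ k)).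

Definition transition_mx (R : realType) (n : nat) (M : 'M[R]_n) (t : R) :
    'M[R[i]]_n :=
  expmx (('i * t%:C)%C *: map_mx (real_complex R) M).

Definition unit_vec (R : realType) (n : nat) (u : 'cV[R]_n) : Prop :=
  u^T *m u = 1%:M.

(* Perfect state transfer is only meant between linearly independent real unit
   vectors; without independence a pair state would transfer to its opposite
   at any time at which it is periodic. *)
Definition perfect_state_transfer (R : realType) (n : nat) (M : 'M[R]_n)
    (u v : 'cV[R]_n) : Prop :=
  [/\ unit_vec u, unit_vec v, free [:: u; v] &
      exists (tau : R) (gamma : R[i]),
        [/\ 0 < tau, `|gamma| = 1 &
            transition_mx M tau *m map_mx (real_complex R) u
            = gamma *: map_mx (real_complex R) v]].

Definition perfect_pair_state_transfer (R : realType) (V : finType)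
    (G : sgraph V) : Prop :=
  exists x y z w : V,
    [/\ x != y, z != w &
        perfect_state_transfer (adjmx R G) (pair_state R x y)
          (pair_state R z w)].

(* Main.v *)
Require Import Defs.
From mathcomp Require Import all_boot all_order all_algebra.
From mathcomp Require Import complex.
From mathcomp Require Import all_classical all_reals all_analysis.
From mathcomp Require Import ring lra zify.

(** The adjacency matrix of the prism over K_n is A = [[J - I, I], [I, 0]].
    If f is an eigenvector of J - I with eigenvalue k and th^2 = k th + 1, then
    (th f, f) is an eigenvector of A with eigenvalue th ([prism_lift_eigen]).
    So A has two sectors: f with zero sum (k = -1, th^2 + th = 1, hence th
    irrational and independent of n), and f constant (k = n - 1).

    Pairing the equation U(tau) u = gamma v with a real eigenvector g of A for
    the eigenvalue th gives exp(i th tau) <g, u> = gamma <g, v>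
    ([pair_state_eigen_phase]).  All moduli are 1 and the pairings are real, so
    <g, v> = +- <g, u> with the sign fixed by exp(i th tau) / gamma.

    In the zero-sum sector take f = e_p - e_q.  Up to the factor 1 / sqrt 2 the
    pairings are th a + b with integers a and b, and irrationality of th turns
    an equality of pairings into equalities of the integers.  Thus, for one
    common sign s, the integer vector d' - s d, where d and d' are sqrt 2 u and
    sqrt 2 v, is constant on each of the two copies of the vertex set
    ([zero_sum_sector]).  Its total is 0, so these constants are c and -c.  If
    c = 0 then v = s u, against independence.  If c is not 0, all 2n
    coordinates are nonzero while at most 4 can be, so n = 2
    ([prism_pair_rigid]).

    For n = 2 the prism is the path P_4.  The constant sector then carries the
    opposite sign -s, and its eigenvalues are l + 1 with l a zero-sum
    eigenvalue.  Therefore exp(i tau) = -1 and, comparing the two zero-sum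
    eigenvalues, exp(i sqrt 5 tau) = 1: both tau and sqrt 5 tau are multiples
    of pi, so tau = 0 by irrationality of sqrt 5 ([golden_phases_time0]). *)

Set Implicit Arguments.
Unset Strict Implicit.
Unset Printing Implicit Defensive.
Import Order.TTheory GRing.Theory Num.Theory.
Import numFieldNormedType.Exports.
Local Open Scope ring_scope.
Local Open Scope classical_set_scope.
Local Open Scope complex_scope.

(** * The exponential series of i t M *)

(* Topology on the complex numbers is found through this projection only. *)
Local Notation numC R := (Num.NumField.sort (complex R)).

Lemma cvg_real_complex (R : realType) (u : nat -> R) (a : R) :
  u @ \oo --> a -> (fun k => (u k)%:C : numC R) @ \oo --> (a%:C : numC R).
Proof.
move=> ua; apply/cvgrPdist_lt => e e0.
have [Ie Re0] : (complex.Im e = 0) * (0 < complex.Re e).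
  by move: e0; rewrite ltcE => /andP[/eqP].
move/cvgrPdist_lt: ua => /(_ _ Re0); apply: filterS => k /= ua.
rewrite -rmorphB normc_def /= expr0n addr0 sqrtr_sqr.
by rewrite ltcE /= Ie eqxx.
Qed.

Lemma cvg_comb (K : numFieldType) (u v : nat -> K) (a b c : K) :
  u @ \oo --> a -> v @ \oo --> b ->
  (fun k => u k + c * v k) @ \oo --> a + c * b.
Proof. by move=> ua vb; apply: cvgD => //; apply: cvgM => //; exact: cvg_cst. Qed.

Lemma cvg_complex (R : realType) (u v : nat -> R) (a b : R) :
  u @ \oo --> a -> v @ \oo --> b ->
  (fun k => u k +i* v k : numC R) @ \oo --> (a +i* b : numC R).
Proof.
move=> ua vb; rewrite [a +i* b]complexE /=.
rewrite (_ : (fun k => _) = (fun k => (u k)%:C + 'i * (v k)%:C)); last first.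
  by apply/funext => k; rewrite [LHS]complexE.
exact: cvg_comb (cvg_real_complex ua) (cvg_real_complex vb).
Qed.

Lemma cvg_mx_entries (K : numFieldType) m n (X : nat -> 'M[K]_(m, n))
    (L : 'M[K]_(m, n)) :
  (forall i j, (fun k => X k i j) @ \oo --> L i j) -> X @ \oo --> L.
Proof.
move=> XL; apply/cvg_mx_entourageP => A entA.
apply: filter_forall => i; apply: filter_forall => j.
have /cvg_app_entourageP/(_ _ entA) := XL i j.
by apply: filterS => k; rewrite /= inE.
Qed.

(** The sum of all absolute values is a crude submultiplicative norm; any
    geometric bound suffices for the exponential series to converge. *)
Lemma expr_entry_bound (R : realDomainType) n (M : 'M[R]_n) k i j :
  `|(M ^+ k) i j| <= (\sum_a \sum_b `|M a b|) ^+ k.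
Proof.
elim: k i j => [|k IH] i j.
  by rewrite !expr0 mxE normr_nat; case: eqP.
rewrite exprS mxE (le_trans (ler_norm_sum _ _ _))// exprS.
rewrite [leRHS](_ : _ = (\sum_b `|M i b|) * (\sum_a \sum_b `|M a b|) ^+ k +
  (\sum_(a | a != i) \sum_b `|M a b|) * (\sum_a \sum_b `|M a b|) ^+ k); last first.
  by rewrite -mulrDl (bigD1 i).
rewrite -[leLHS]addr0 lerD//; last first.
  by rewrite mulr_ge0 ?exprn_ge0 ?sumr_ge0// => *; rewrite sumr_ge0.
by rewrite mulr_suml ler_sum// => l _; rewrite normrM ler_wpM2l.
Qed.

Definition cis (R : realType) (x : R) : R[i] := cos x +i* sin x.

(** The terms of the exponential series at i t are real or purely imaginary
    according to the parity of k, which is how sine and cosine are defined. *)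
Lemma cis_coeffE (R : realType) (t : R) k :
  (k`!%:R)^-1 * ('i * t%:C) ^+ k = cos_coeff t k +i* sin_coeff t k.
Proof.
have iE m : ('i : R[i]) ^+ m.*2 = ((-1) ^+ m)%:C.
  by rewrite -muln2 mulnC exprM sqr_i rmorphXn rmorphN1.
have natC : (k`!%:R : R[i])^-1 = (k`!%:R^-1 : R)%:C.
  by rewrite fmorphV rmorph_nat.
rewrite /cos_coeff /sin_coeff /= natC exprMn -rmorphXn.
have [m [->|->]] : exists m, k = m.*2 \/ k = m.*2.+1.
  exists k./2; rewrite -{1 3}(odd_double_half k).
  by case: (odd k); [right|left].
- rewrite iE /= odd_double doubleK; apply/eqP; rewrite eq_complex /= -!exprnP.
  by apply/andP; split; apply/eqP; ring.
rewrite exprS iE /= odd_double doubleK; apply/eqP; rewrite eq_complex /= -!exprnP.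
by apply/andP; split; apply/eqP; ring.
Qed.

Lemma normc_cis (R : realType) (x : R) : `|cis x| = 1.
Proof. by rewrite normc_def /= cos2Dsin2 sqrtr1. Qed.

Lemma cisD (R : realType) (x y : R) : cis (x + y) = cis x * cis y.
Proof.
by apply/eqP; rewrite eq_complex /= cosD sinD addrC eqxx; apply/eqP; ring.
Qed.

(** Meant for c the coefficients of cos or sin at t and m an entry of the
    powers of a matrix: the exponential series at |t| C dominates. *)
Lemma series_trig_cvg (R : realType) (t C : R) (c m : nat -> R) :
  (forall k, `|c k| <= exp_coeff `|t| k) -> (forall k, `|m k| <= C ^+ k) ->
  cvgn (series (fun k => c k * m k)).
Proof.
move=> cb mb; have C0 : 0 <= C by rewrite -[C]expr1 (le_trans _ (mb 1%N)).
apply: normed_cvg.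
apply: (@series_le_cvg _ _ (exp_coeff (`|t| * C))); last exact: is_cvg_series_exp_coeff.
- by move=> k /=.
- by move=> k; rewrite exp_coeff_ge0 ?mulr_ge0.
move=> k /=; rewrite normrM (le_trans (ler_pM _ _ (cb k) (mb k)))//.
by rewrite /exp_coeff /= exprMn mulrAC.
Qed.

Lemma norm_cos_coeff (R : realType) (t : R) k : `|cos_coeff t k| <= exp_coeff `|t| k.
Proof.
rewrite /exp_coeff /cos_coeff /= !normrM normfV !normr_nat !normrX normrN1.
rewrite expr1n mulr1 -mulrA ler_piMl ?divr_ge0//.
by case: odd.
Qed.

Lemma norm_sin_coeff (R : realType) (t : R) k : `|sin_coeff t k| <= exp_coeff `|t| k.
Proof.
rewrite /exp_coeff /sin_coeff /= !normrM normfV !normr_nat !normrX normrN1.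
rewrite expr1n mulr1 -mulrA ler_piMl ?divr_ge0//.
by case: odd.
Qed.

Lemma exprZmx (R : comPzRingType) n (a : R) (M : 'M[R]_n) k :
  (a *: M) ^+ k = a ^+ k *: M ^+ k.
Proof.
elim: k => [|k IH]; first by rewrite !expr0 scale1r.
rewrite !exprS IH -!mulmxE -scalemxAl -scalemxAr scalerA.
by rewrite -exprS.
Qed.

Lemma transition_entry_series (R : realType) n (M : 'M[R]_n) (t : R) N i j :
  series (fun k => (k`!%:R)^-1 *: (('i * t%:C) *: map_mx (real_complex R) M) ^+ k) N i j
  = series (fun k => cos_coeff t k * (M ^+ k) i j) N +i*
    series (fun k => sin_coeff t k * (M ^+ k) i j) N.
Proof.
rewrite /series /= summxE.
elim: N => [|N IH]; first by rewrite !big_nil.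
rewrite !big_nat_recr //= IH exprZmx.
rewrite !mxE mulrA cis_coeffE.
have -> : (map_mx (real_complex R) M ^+ N) i j = ((M ^+ N) i j)%:C.
  have -> : map_mx (real_complex R) M ^+ N = map_mx (real_complex R) (M ^+ N).
    elim: N {IH} => [|N IH]; first by rewrite !expr0 map_mx1.
    by rewrite !exprS map_mxM IH.
  by rewrite mxE.
apply/eqP; rewrite eq_complex /=; apply/andP; split; apply/eqP; ring.
Qed.

(** The matrix exponential is a limit, a junk value unless its series
    converges.  Working entrywise, on real and imaginary parts, reduces its
    convergence to completeness of the reals. *)
Lemma transition_mx_entry (R : realType) n (M : 'M[R]_n) (t : R) i j :
  transition_mx M t i j =
    limn (series (fun k => cos_coeff t k * (M ^+ k) i j)) +i*
    limn (series (fun k => sin_coeff t k * (M ^+ k) i j)).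
Proof.
rewrite /transition_mx /expmx.
set X := series _.
pose L : 'M[numC R]_n := \matrix_(i, j)
    (limn (series (fun k => cos_coeff t k * (M ^+ k) i j)) +i*
    limn (series (fun k => sin_coeff t k * (M ^+ k) i j))).
have XL : X @ \oo --> L.
  apply: cvg_mx_entries => {}i {}j.
  rewrite mxE.
  rewrite (_ : (fun k => _) = (fun N =>
    series (fun k => cos_coeff t k * (M ^+ k) i j) N +i*
    series (fun k => sin_coeff t k * (M ^+ k) i j) N)); last first.
    by apply/funext => N; exact: transition_entry_series.
  apply: cvg_complex.
    apply: series_trig_cvg (norm_cos_coeff t) _ => k.
    exact: expr_entry_bound.
  apply: series_trig_cvg (norm_sin_coeff t) _ => k.
  exact: expr_entry_bound.
by rewrite (cvg_lim _ XL) ?mxE.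
Qed.

Lemma left_eigen_expr (R : pzRingType) n (M : 'M[R]_n) (w : 'rV[R]_n) th k :
  w *m M = th *: w -> w *m M ^+ k = th ^+ k *: w.
Proof.
move=> wM; elim: k => [|k IH]; first by rewrite !expr0 mulmx1 scale1r.
by rewrite !exprSr -mulmxE mulmxA IH -scalemxAl wM scalerA.
Qed.

(** A left eigenvector commutes with the limit of a power series in M, since
    each partial sum multiplies it by the scalar partial sum at th. *)
Lemma eigen_series_lim (R : realType) n (M : 'M[R]_n) (w : 'rV[R]_n)
    (th : R) (c : nat -> R) (l : R) j :
  w *m M = th *: w ->
  (forall i, cvgn (series (fun k => c k * (M ^+ k) i j))) ->
  series (fun k => c k * th ^+ k) @ \oo --> l ->
  \sum_i w 0 i * limn (series (fun k => c k * (M ^+ k) i j)) = l * w 0 j.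
Proof.
move=> wM cM cl.
pose S N := \sum_i w 0 i * series (fun k => c k * (M ^+ k) i j) N.
have SE N : S N = series (fun k => c k * th ^+ k) N * w 0 j.
  rewrite /S /series /=.
  under eq_bigr do rewrite mulr_sumr.
  rewrite exchange_big mulr_suml; apply: eq_bigr => k _ /=.
  have /(congr1 (fun v : 'rV_n => v 0 j)) := left_eigen_expr k wM.
  rewrite !mxE => E; rewrite -mulrA -E mulr_sumr.
  by apply: eq_bigr => i _; rewrite mulrCA.
have S1 : S @ \oo --> \sum_i w 0 i * limn (series (fun k => c k * (M ^+ k) i j)).
  by apply: cvg_big => [|i _]; [exact: add_continuous|apply: cvgMr; exact: cM].
have S2 : S @ \oo --> l * w 0 j.
  by rewrite (funext SE); apply: cvgMl.
exact: cvg_unique S1 S2.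
Qed.

Lemma transition_left_eigen (R : realType) n (M : 'M[R]_n) (w : 'rV[R]_n)
    (th t : R) :
  w *m M = th *: w ->
  map_mx (real_complex R) w *m transition_mx M t
  = cis (th * t) *: map_mx (real_complex R) w.
Proof.
move=> wM; apply/rowP => j; rewrite !mxE.
have cE : \sum_i w 0 i * limn (series (fun k => cos_coeff t k * (M ^+ k) i j))
    = cos (th * t) * w 0 j.
  apply: eigen_series_lim wM _ _ => [i|].
    by apply: series_trig_cvg (norm_cos_coeff t) _ => k; exact: expr_entry_bound.
  rewrite [X in series X](_ : _ = cos_coeff (th * t)); last first.
    by apply/funext => k; rewrite /cos_coeff /= exprMn; ring.
  by rewrite cos.unlock; exact: is_cvg_series_cos_coeff.
have sE : \sum_i w 0 i * limn (series (fun k => sin_coeff t k * (M ^+ k) i j))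
    = sin (th * t) * w 0 j.
  apply: eigen_series_lim wM _ _ => [i|].
    by apply: series_trig_cvg (norm_sin_coeff t) _ => k; exact: expr_entry_bound.
  rewrite [X in series X](_ : _ = sin_coeff (th * t)); last first.
    by apply/funext => k; rewrite /sin_coeff /= exprMn; ring.
  by rewrite sin.unlock; exact: is_cvg_series_sin_coeff.
rewrite (eq_bigr (fun i =>
   (w 0 i * limn (series (fun k => cos_coeff t k * (M ^+ k) i j)))%:C +
   'i * (w 0 i * limn (series (fun k => sin_coeff t k * (M ^+ k) i j)))%:C)).
  rewrite big_split /= -mulr_sumr -!rmorph_sum cE sE.
  apply/eqP; rewrite eq_complex /=; apply/andP; split; apply/eqP; ring.
move=> i _; rewrite mxE transition_mx_entry.
apply/eqP; rewrite eq_complex /=; apply/andP; split; apply/eqP; ring.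
Qed.

(** * Phases at eigenvectors *)

(** The necessary condition for perfect state transfer used throughout: one
    scalar equation for each real eigenvector, with no need to diagonalize M. *)
Lemma pst_eigen_phase (R : realType) n (M : 'M[R]_n) (u v : 'cV[R]_n) tau gamma
    (w : 'rV[R]_n) th :
  transition_mx M tau *m map_mx (real_complex R) u
            = gamma *: map_mx (real_complex R) v ->
  w *m M = th *: w ->
  cis (th * tau) * ((w *m u) 0 0)%:C = gamma * ((w *m v) 0 0)%:C.
Proof.
move=> Uu wM.
have /(congr1 (fun X => (map_mx (real_complex R) w *m X) 0 0)) := Uu.
rewrite mulmxA (transition_left_eigen _ wM) -scalemxAl -scalemxAr -!map_mxM.
have entry (a : R[i]) (X : 'M[R]_1) :
  (a *: map_mx (real_complex R) X) 0 0 = a * (X 0 0)%:C by rewrite !mxE.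
by rewrite !entry.
Qed.

Definition eigenfunction (R : realType) (V : finType) (G : sgraph V) (th : R)
    (g : V -> R) := forall x, \sum_y (G x y)%:R * g y = th * g x.

Lemma pair_state_eigen_phase (R : realType) (V : finType) (G : sgraph V)
    x y z w tau gamma th (g : V -> R) :
  transition_mx (adjmx R G) tau *m map_mx (real_complex R) (pair_state R x y)
            = gamma *: map_mx (real_complex R) (pair_state R z w) ->
  eigenfunction G th g ->
  cis (th * tau) * (g x - g y)%:C = gamma * (g z - g w)%:C.
Proof.
move=> Uu gE.
pose W : 'rV[R]_#|V| := \row_i g (enum_val i).
have WM : W *m adjmx R G = th *: W.
  apply/rowP => j; rewrite !mxE -gE (reindex _ (onW_bij _ (@enum_val_bij V))) /=.
  by apply: eq_bigr => i _; rewrite !mxE mulrC (adj_sym G).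
have Wpair a b : (W *m pair_state R a b) 0 0 = (Num.sqrt 2)^-1 * (g a - g b).
  rewrite /pair_state -scalemxAr mulmxBr mxE; congr (_ * _).
  have W1 c : (W *m charvec R c) 0 0 = g c.
    by rewrite /charvec -colE !mxE enum_rankK.
  by rewrite mxE W1 mxE W1.
(* The common normalization 1 / sqrt 2 of the two pair states cancels. *)
have := pst_eigen_phase Uu WM; rewrite !Wpair !rmorphM /= mulrCA [RHS]mulrCA.
apply: mulfI; rewrite (inj_eq (@complexI R) _ 0) invr_eq0 sqrtr_eq0 -ltNge ltr0n.
by [].
Qed.

Lemma phase_sign (R : realType) (c gamma : R[i]) (x y : R) :
  `|c| = 1 -> `|gamma| = 1 -> x != 0 -> c * x%:C = gamma * y%:C ->
  exists b : bool, c = (-1) ^+ b * gamma /\ y = (-1) ^+ b * x.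
Proof.
move=> c1 g1 x0 E.
have xC0 : x%:C != 0 :> R[i] by rewrite (inj_eq (@complexI R) _ 0).
have g0 : gamma != 0 by rewrite -normr_gt0 g1.
have yx : `|y| = `|x|.
  apply: (@complexI R); have := congr1 Num.norm E.
  by rewrite !normrM c1 g1 !mul1r !normc_def /= !expr0n !addr0 !sqrtr_sqr.
have /orP[/eqP yE|/eqP yE] : (y == x) || (y == - x) by rewrite -eqr_norm2 yx.
  exists false; rewrite !mul1r; split=> //; apply: (mulIf xC0).
  by rewrite E yE.
exists true; rewrite !mulN1r; split=> //; apply: (mulIf xC0).
by rewrite E yE rmorphN mulrN mulNr.
Qed.

(** * The golden ratio and multiples of 2 pi *)

Lemma cos_eq1_2pi (R : realType) (x : R) :
  cos x = 1 -> exists k : int, x = k%:~R * (pi *+ 2).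
Proof.
move=> cx; have p0 : 0 < pi *+ 2 :> R by rewrite mulrn_wgt0 ?pi_gt0.
(* k is the number of full turns, so that x - 2 pi k lies in [0, 2 pi[. *)
pose k := Num.floor (x / (pi *+ 2)).
exists k.
pose y := x - k%:~R * (pi *+ 2).
have cosk (m : nat) (t : R) : cos (t + m%:R * (pi *+ 2)) = cos t.
  by rewrite mulr_natl; exact: (periodicn (@cosD2pi R)).
have cy : cos y = 1.
  rewrite /y -[RHS]cx; case: (k) => m.
    by rewrite -[LHS](cosk m) -pmulrn subrK.
  by rewrite NegzE mulrNz mulNr opprK -pmulrn cosk.
have y0 : 0 <= y by rewrite subr_ge0 -ler_pdivlMr// floor_le_tmp.
have y1 : y < pi *+ 2.
  have := floorD1_gt (x / (pi *+ 2)).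
  by rewrite ltr_pdivrMr// intrD mulrDl mul1r /y ltrBlDl.
apply/eqP; rewrite -subr_eq0 -/y; apply/eqP/le_anti; rewrite y0 andbT leNgt.
apply/negP => yp.
(* cos y = 1 - 2 sin(y / 2)^2, and sine is positive inside ]0, pi[. *)
have s0 : 0 < sin (y / 2).
  by apply: sin_gt0_pi; rewrite divr_gt0//= ltr_pdivrMr// mulr_natr.
have := cos_mulr2n (y / 2); rewrite -[_ / 2 *+ 2]mulr_natr divfK ?pnatr_eq0// cy cos2sin2.
have : 0 < sin (y / 2) ^+ 2 by rewrite exprn_gt0.
lra.
Qed.

(** Irrationality of sqrt 5, by parity of the 5-adic valuation. *)
Lemma sqr_eq_5sqr (a b : int) : a ^+ 2 = 5 * b ^+ 2 -> b = 0.
Proof.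
move=> ab; apply/eqP; rewrite -absz_eq0 -leqn0 leqNgt; apply/negP => b0.
have E : (`|a| ^ 2 = 5 * `|b| ^ 2)%N by rewrite -!abszX ab abszM.
have := congr1 (logn 5) E; rewrite lognM ?expn_gt0 ?b0// !lognX.
rewrite (_ : logn 5 5 = 1)%N//; lia.
Qed.

(** The roots of X^2 + X - 1 are irrational: l a + b = 0 would give
    (2 b - a)^2 = 5 a^2. *)
Lemma golden_free (R : numDomainType) (l : R) (a b : int) :
  l ^+ 2 + l = 1 -> l * a%:~R + b%:~R = 0 -> a = 0 /\ b = 0.
Proof.
move=> l1 ab.
have bE : b%:~R = - (l * a%:~R) by apply/eqP; rewrite -addr_eq0 addrC ab.
have a0 : a = 0.
  apply: (@sqr_eq_5sqr (2 * b - a)); apply: (@intr_inj R).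
  rewrite !(rmorphXn, rmorphB, rmorphM) /= bE.
  transitivity ((4 * (l ^+ 2 + l) + 1) * a%:~R ^+ 2); first by ring.
  by rewrite l1; ring.
split=> //; apply: (@intr_inj R); rewrite bE a0; ring.
Qed.

Lemma golden_root (R : rcfType) : exists l : R, l ^+ 2 + l = 1.
Proof.
exists ((Num.sqrt 5 - 1) / 2).
have : Num.sqrt 5 ^+ 2 = 5 :> R by rewrite sqr_sqrtr.
lra.
Qed.

(** The eigenvalues of P_4 are l, -1 - l, l + 1 and -l with l^2 + l = 1.
    Comparing the first and the third phase gives cis t = -1, comparing the
    first two gives cis ((2 l + 1) t) = 1, where (2 l + 1)^2 = 5. *)
Lemma golden_phases_time0 (R : realType) (t : R) (s : R[i]) (l : R) :
  l ^+ 2 + l = 1 ->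
  s != 0 -> cis (l * t) = s -> cis ((- 1 - l) * t) = s ->
  cis ((l + 1) * t) = - s -> t = 0.
Proof.
move=> lE s0 cl cm cl1.
have c1 : cis t = -1.
  by apply: (mulfI s0); rewrite -[in LHS]cl -cisD mulrN1 -cl1 mulrDl mul1r.
have cosE (u : R) : cis u = 1 -> exists k : int, u = k%:~R * (pi *+ 2).
  by move=> cu; apply: cos_eq1_2pi; case: cu.
have [k kE] : exists k : int, (2 * l + 1) * t = k%:~R * (pi *+ 2).
  apply: cosE; apply: (mulfI s0); rewrite mulr1 -[in LHS]cm -cisD -cl.
  by congr cis; ring.
have [j jE] : exists j : int, 2 * t = j%:~R * (pi *+ 2).
  by apply: cosE; rewrite mulr_natl mulr2n cisD c1 mulrNN mulr1.
have p0 : pi != 0 :> R by rewrite gt_eqF ?pi_gt0.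
have tE : t = j%:~R * pi by lra.
have jk : (2 * l + 1) * j%:~R = 2 * k%:~R.
  by apply: (mulIf p0); rewrite -mulrA -tE kE -mulr_natl; ring.
suff j0 : j = 0 by rewrite tE j0 mul0r.
apply: (@sqr_eq_5sqr (2 * k)); apply: (@intr_inj R).
rewrite !(rmorphXn, rmorphM) /= -jk exprMn; congr (_ * _).
transitivity (4 * (l ^+ 2 + l) + 1); first by ring.
by rewrite lE; ring.
Qed.

(** * Eigenvectors of the prism over a complete graph *)

Definition prism_lift (R : pzSemiRingType) (T : Type) (th : R) (f : T -> R)
    (v : T + T) : R :=
  match v with inl a => th * f a | inr a => f a end.

(** The lower half of the prism matrix is [I, 0], which forces the shape
    (th f, f); the upper half then asks that k th + 1 = th^2. *)
Lemma prism_lift_eigen (R : realType) (T : finType) (f : T -> R) (k th : R) :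
  (forall a, \sum_(b | b != a) f b = k * f a) -> th ^+ 2 = k * th + 1 ->
  eigenfunction (compl_prism (complete_graph T)) th (prism_lift th f).
Proof.
move=> fE thE x; rewrite big_sumType /=.
have indic a : \sum_b (a == b)%:R * f b = f a.
  rewrite (bigD1 a)//= eqxx mul1r big1 ?addr0// => b.
  by rewrite eq_sym => /negbTE ->; rewrite mul0r.
case: x => a /=.
  rewrite indic -[X in _ + X]mul1r mulrA -expr2 thE mulrDl; congr (_ + _).
  rewrite mulrAC -fE mulr_suml [RHS]big_mkcond; apply: eq_bigr => b _.
  by rewrite eq_sym; case: ifP; rewrite ?mul1r ?mul0r// mulrC.
rewrite [X in _ + X]big1 => [|b _]; last by case: (a == b); rewrite mul0r.
rewrite addr0 -indic mulr_sumr; apply: eq_bigr => b _; exact: mulrCA.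
Qed.

Lemma prism_delta_eigen (R : realType) (T : finType) (p q : T) (th : R) :
  th ^+ 2 + th = 1 ->
  eigenfunction (compl_prism (complete_graph T)) th
    (prism_lift th (fun a => (a == p)%:R - (a == q)%:R)).
Proof.
move=> thE; apply: (@prism_lift_eigen _ _ _ (-1)); last by lra.
have sum1 r : \sum_b (b == r)%:R = 1 :> R.
  by rewrite (bigD1 r)//= eqxx big1 ?addr0// => b /negbTE ->.
move=> a; apply/eqP; rewrite mulN1r -addr_eq0 addrC; apply/eqP.
transitivity (\sum_b ((b == p)%:R - (b == q)%:R) : R); first by rewrite [RHS](bigD1 a).
by rewrite sumrB !sum1 subrr.
Qed.

Lemma prism_one_eigen (R : realType) (T : finType) (th : R) :
  th ^+ 2 = (#|T|.-1)%:R * th + 1 ->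
  eigenfunction (compl_prism (complete_graph T)) th
    (prism_lift th (fun=> 1)).
Proof.
apply: prism_lift_eigen => a.
by rewrite mulr1 sumr_const -(cardC1 a).
Qed.

(** * Pair states as integer vectors *)

(** The integer vector sqrt 2 times the pair state: irrationality arguments
    need coordinates in the integers. *)
Definition pair_coord (V : eqType) (x y v : V) : int := (x == v)%:R - (y == v)%:R.

Lemma prism_lift_delta_diff (R : realType) (T : finType) (p q : T) (th : R)
    (x y : T + T) :
  let g := prism_lift th (fun a => (a == p)%:R - (a == q)%:R) in
  let d := pair_coord x y in
  g x - g y = th * (d (inl p) - d (inl q))%:~R + (d (inr p) - d (inr q))%:~R.
Proof.
have E v : prism_lift th (fun a => (a == p)%:R - (a == q)%:R) v =
   th * ((v == inl p)%:R - (v == inl q)%:R) + ((v == inr p)%:R - (v == inr q)%:R).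
  by case: v => a /=; rewrite ?subrr ?mulr0 ?add0r ?addr0.
rewrite /= !E /pair_coord !(rmorphB, rmorph_nat) /=.
ring.
Qed.

Definition on_left (S T : Type) (v : S + T) : bool := if v is inl _ then true else false.

Lemma prism_lift_one_diff (R : realType) (T : finType) (th : R) (x y : T + T) :
  let g := prism_lift th (fun=> 1) in
  g x - g y = (th - 1) * ((on_left x)%:R - (on_left y)%:R : int)%:~R.
Proof. by rewrite rmorphB !rmorph_nat; case: x y => a [] b /=; ring. Qed.

Lemma sum_pair_coord_left (T : finType) (x y : T + T) :
  \sum_a pair_coord x y (inl a) = (on_left x)%:R - (on_left y)%:R.
Proof.
have E (v : T + T) : \sum_a (v == inl a)%:R = (on_left v)%:R :> int.
  case: v => b; last by rewrite big1.
  rewrite (bigD1 b)//= eqxx big1 ?addr0// => a ab.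
  by rewrite (inj_eq (@inl_inj _ _)) eq_sym (negbTE ab).
by rewrite sumrB !E.
Qed.

Lemma sum_pair_coord (V : finType) (x y : V) : \sum_v pair_coord x y v = 0.
Proof.
have E (u : V) : \sum_v (u == v)%:R = 1 :> int.
  by rewrite (bigD1 u)//= eqxx big1 ?addr0// => v; rewrite eq_sym => /negbTE ->.
by rewrite sumrB !E subrr.
Qed.

(** A pair vector jumps at x inside the copy containing x: it is 1 at x and
    at most 0 elsewhere. *)
Lemma pair_coord_nonconst (T : finType) (x y : T + T) : (1 < #|T|)%N -> x != y ->
  exists p q, (pair_coord x y (inl p) - pair_coord x y (inl q),
               pair_coord x y (inr p) - pair_coord x y (inr q)) != (0, 0).
Proof.
move=> cT xy.
have other (a : T) : exists b, b != a.
  have : (0 < #|predC1 a|)%N by rewrite cardC1; lia.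
  by move=> /card_gt0P[b]; exists b.
have jump (u v : T + T) : u != y -> v != u -> pair_coord u y u - pair_coord u y v != 0.
  rewrite /pair_coord (eq_sym y u) (eq_sym u v) eqxx => /negbTE -> /negbTE ->.
  by case: (y == v).
case: x xy => a xy; have [b ba] := other a; exists a, b;
  by rewrite xpair_eqE negb_and !jump ?orbT.
Qed.

(** The coordinates of d' - s d are a constant k on the left copy and, the
    total being 0, -k on the right copy.  Either k = 0, or the whole vertex set
    lies in {x, y, z, w}, whence 2 #|T| <= 4; the second conjunct of the
    exceptional case records that k is not 0. *)
Lemma prism_pair_rigid (T : finType) (x y z w : T + T) (s : int) :
  let d := pair_coord x y in let d' := pair_coord z w in
  (1 < #|T|)%N ->
  (forall p q, d' (inl p) - d' (inl q) = s * (d (inl p) - d (inl q))) ->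
  (forall p q, d' (inr p) - d' (inr q) = s * (d (inr p) - d (inr q))) ->
  (forall v, d' v = s * d v) \/
  (#|T| = 2 /\ \sum_a d' (inl a) <> s * \sum_a d (inl a)).
Proof.
move=> d d' cT dl dr.
have /card_gt0P[t _] : (0 < #|T|)%N by lia.
pose e v := d' v - s * d v; pose k := e (inl t); pose k' := e (inr t).
have el a : e (inl a) = k.
  apply/eqP; rewrite -subr_eq0 (_ : _ - _ =
    (d' (inl a) - d' (inl t)) - s * (d (inl a) - d (inl t))).
    by rewrite dl subrr.
  by rewrite /k /e; ring.
have er a : e (inr a) = k'.
  apply/eqP; rewrite -subr_eq0 (_ : _ - _ =
    (d' (inr a) - d' (inr t)) - s * (d (inr a) - d (inr t))).
    by rewrite dr subrr.
  by rewrite /k' /e; ring.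
have suml : \sum_a e (inl a) = k *+ #|T| by rewrite (eq_bigr _ (fun a _ => el a)) sumr_const.
have sumr : \sum_a e (inr a) = k' *+ #|T| by rewrite (eq_bigr _ (fun a _ => er a)) sumr_const.
have kk' : k' = - k.
  have : \sum_v e v = 0 by rewrite sumrB -mulr_sumr !sum_pair_coord mulr0 subrr.
  rewrite big_sumType /= suml sumr -mulrnDl => /eqP; rewrite mulrn_eq0 => /orP[|/eqP]; lia.
have [k0|k0] := eqVneq k 0.
  left=> v; apply/eqP; rewrite -subr_eq0; apply/eqP; rewrite -/(e v).
  by case: v => a; rewrite ?el ?er ?kk' k0 ?oppr0.
right; have eN0 v : e v != 0 by case: v => a; rewrite ?el ?er ?kk' ?oppr_eq0.
have : (#|{: T + T}| <= 4)%N.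
  apply: leq_trans (card_size [:: x; y; z; w]); apply: subset_leq_card.
  apply/fintype.subsetP => v _; have := eN0 v; apply: contraNT.
  rewrite !inE !negb_or => /and4P[vx vy vz vw].
  rewrite /e /d /d' /pair_coord !(eq_sym _ v).
  by rewrite (negbTE vx) (negbTE vy) (negbTE vz) (negbTE vw) subrr mulr0.
rewrite card_sum => c4; split; first lia.
move/eqP; rewrite mulr_sumr -subr_eq0 -sumrB -/e suml mulrn_eq0 (negbTE k0) orbF.
by move/eqP; lia.
Qed.

Lemma pair_state_coordE (R : realType) (V : finType) (x y : V) i :
  pair_state R x y i 0 = (Num.sqrt 2)^-1 * (pair_coord x y (enum_val i))%:~R.
Proof.
rewrite !mxE eqxx !andbT /pair_coord rmorphB /= !rmorph_nat.
have E c : (i == enum_rank c) = (c == enum_val i).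
  by rewrite -(inj_eq enum_val_inj) enum_rankK eq_sym.
by rewrite !E.
Qed.

Lemma pair_state_not_free (R : realType) (V : finType) (x y z w : V) (s : int) :
  (forall v, pair_coord z w v = s * pair_coord x y v) ->
  ~~ free [:: pair_state R x y; pair_state R z w].
Proof.
move=> E.
have -> : pair_state R z w = s%:~R *: pair_state R x y.
  apply/colP => i; rewrite [RHS]mxE !pair_state_coordE E rmorphM /=; ring.
rewrite (perm_free (_ : perm_eq _ [:: s%:~R *: pair_state R x y; pair_state R x y])).
  by rewrite free_cons span_seq1 memvZ// memv_line.
by rewrite (perm_catC [:: _] [:: _]).
Qed.

(** * The two sectors *)

(** Irrationality of l separates the two integer coordinates, so the sign that
    relates the pairings relates the differences themselves.  Some difference
    of d is nonzero, hence the sign is the same for both roots l. *)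
Lemma zero_sum_sector (R : realType) (T : finType) (x y z w : T + T) (tau : R)
    (gamma : R[i]) :
  let d := pair_coord x y in let d' := pair_coord z w in
  (1 < #|T|)%N -> x != y -> `|gamma| = 1 ->
  transition_mx (adjmx R (compl_prism (complete_graph T))) tau
      *m map_mx (real_complex R) (pair_state R x y)
    = gamma *: map_mx (real_complex R) (pair_state R z w) ->
  exists b : bool,
    [/\ forall l : R, l ^+ 2 + l = 1 -> cis (l * tau) = (-1) ^+ b * gamma,
        forall p q, d' (inl p) - d' (inl q)
                    = (-1) ^+ b * (d (inl p) - d (inl q)) &
        forall p q, d' (inr p) - d' (inr q)
                    = (-1) ^+ b * (d (inr p) - d (inr q))].
Proof.
move=> d d' T1 xy g1 Ut.
have g0 : gamma != 0 by rewrite -normr_gt0 g1.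
have phase l p q : l ^+ 2 + l = 1 ->
    cis (l * tau) * (l * (d (inl p) - d (inl q))%:~R
                       + (d (inr p) - d (inr q))%:~R)%:C =
    gamma * (l * (d' (inl p) - d' (inl q))%:~R
                 + (d' (inr p) - d' (inr q))%:~R)%:C.
  move=> lE; have := pair_state_eigen_phase Ut (prism_delta_eigen p q lE).
  by rewrite !prism_lift_delta_diff.
have split_phase l p q (b : bool) : l ^+ 2 + l = 1 ->
    l * (d' (inl p) - d' (inl q))%:~R + (d' (inr p) - d' (inr q))%:~R =
    (-1) ^+ b * (l * (d (inl p) - d (inl q))%:~R
                 + (d (inr p) - d (inr q))%:~R) :> R ->
    d' (inl p) - d' (inl q) = (-1) ^+ b * (d (inl p) - d (inl q)) /\
    d' (inr p) - d' (inr q) = (-1) ^+ b * (d (inr p) - d (inr q)).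
  move=> lE E.
  have [] := @golden_free R l
    (d' (inl p) - d' (inl q) - (-1) ^+ b * (d (inl p) - d (inl q)))
    (d' (inr p) - d' (inr q) - (-1) ^+ b * (d (inr p) - d (inr q))) lE.
    rewrite !(rmorphB _ _ (_ * _)) !rmorphM !rmorph_sign /= mulrBr addrACA E.
    ring.
  by move=> /eqP + /eqP; rewrite !subr_eq0 => /eqP -> /eqP ->.
have [p0 [q0 pq0]] := pair_coord_nonconst T1 xy.
have sign l : l ^+ 2 + l = 1 -> exists b : bool,
    cis (l * tau) = (-1) ^+ b * gamma /\
    (d' (inl p0) - d' (inl q0), d' (inr p0) - d' (inr q0)) =
    ((-1) ^+ b * (d (inl p0) - d (inl q0)),
     (-1) ^+ b * (d (inr p0) - d (inr q0))).
  move=> lE.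
  have [|b [cb yb]] := phase_sign (normc_cis _) g1 _ (phase l p0 q0 lE).
    by apply: contra_neq pq0 => /(golden_free lE)[-> ->].
  by exists b; split=> //; have [-> ->] := split_phase l p0 q0 b lE yb.
have [l lE] := golden_root R.
have [b [cl dl]] := sign l lE.
have diffE p q : d' (inl p) - d' (inl q) = (-1) ^+ b * (d (inl p) - d (inl q))
    /\ d' (inr p) - d' (inr q) = (-1) ^+ b * (d (inr p) - d (inr q)).
  apply: (split_phase l p q b lE); have := phase l p q lE.
  rewrite cl mulrAC mulrC => /(mulfI g0) E; apply: (@complexI R).
  by rewrite -E rmorphM rmorph_sign.
exists b; split=> [m mE|p q|p q]; [|by have [] := diffE p q|by have [] := diffE p q].
have [b' [-> dm]] := sign m mE; congr (_ ^+ _ * _); congr nat_of_bool.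
move: dm; rewrite dl => -[]; move: pq0; rewrite xpair_eqE.
move: (pair_coord x y (inl p0) - _) (pair_coord x y (inr p0) - _) => u v.
by case: b b' {cl dl diffE} => -[];
  rewrite ?expr0 ?expr1 ?mul1r ?mulN1r //; lia.
Qed.

(** For #|T| = 2 the constant sector has eigenvalue l + 1, and pairing with its
    eigenvector reads off the sum of d over the left copy.  Those sums agree up
    to the sign of this sector, which therefore differs from any sign b for
    which they disagree. *)
Lemma constant_sector (R : realType) (T : finType) (x y z w : T + T) (tau : R)
    (gamma : R[i]) (l : R) (b : bool) :
  #|T| = 2 -> `|gamma| = 1 -> l ^+ 2 + l = 1 ->
  transition_mx (adjmx R (compl_prism (complete_graph T))) tau
      *m map_mx (real_complex R) (pair_state R x y)
    = gamma *: map_mx (real_complex R) (pair_state R z w) ->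
  \sum_a pair_coord z w (inl a) <> (-1) ^+ b * \sum_a pair_coord x y (inl a) ->
  cis ((l + 1) * tau) = - ((-1) ^+ b * gamma).
Proof.
move=> T2 g1 lE Ut; rewrite !sum_pair_coord_left.
have muE : (l + 1) ^+ 2 = (#|T|.-1)%:R * (l + 1) + 1 by rewrite T2 /=; lra.
have := pair_state_eigen_phase Ut (prism_one_eigen muE).
rewrite !prism_lift_one_diff addrK.
move: (_ - _ : int) (_ - _ : int) => S' S E sS.
have g0 : gamma != 0 by rewrite -normr_gt0 g1.
have l0 : l != 0.
  by apply: contra_eq_neq lE => ->; rewrite expr0n add0r eq_sym oner_eq0.
have S0 : S != 0.
  apply/eqP => S0; apply: sS; rewrite S0 mulr0; apply: (@intr_inj R).
  apply: (mulfI l0); apply: (@complexI R); apply: (mulfI g0).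
  by rewrite -E S0 mulr0z !mulr0.
have lS0 : l * S%:~R != 0 by rewrite mulf_neq0 ?intr_eq0.
have [c [-> cS]] := phase_sign (normc_cis _) g1 lS0 E.
have SE : S' = (-1) ^+ c * S.
  apply: (@intr_inj R); apply: (mulfI l0).
  by rewrite cS rmorphM rmorph_sign mulrCA.
have cb : c = ~~ b by move: sS; rewrite SE; case: c b {cS SE} => -[].
by rewrite cb signrN mulNr.
Qed.

Theorem theorem10 (R : realType) (n : nat) (hn : (2 <= n)%N) :
  ~ perfect_pair_state_transfer R (compl_prism (complete_graph 'I_n)).
Proof.
move=> [x [y [z [w [xy zw [_ _ fuv [tau [gamma [tau0 g1 Ut]]]]]]]]].
have n1 : (1 < #|'I_n|)%N by rewrite card_ord.
have [b [cE dl dr]] := zero_sum_sector n1 xy g1 Ut.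
have [|[n2 sumN]] := prism_pair_rigid n1 dl dr.
  by move=> /pair_state_not_free-/(_ R); rewrite fuv.
have [l lE] := golden_root R.
have s0 : (-1) ^+ b * gamma != 0 by rewrite mulf_neq0 ?signr_eq0// -normr_gt0 g1.
(* The second root of X^2 + X - 1 is -1 - l. *)
have mE : (- 1 - l) ^+ 2 + (- 1 - l) = 1 by rewrite -[RHS]lE; ring.
have := golden_phases_time0 lE s0 (cE _ lE) (cE _ mE)
  (constant_sector n2 g1 lE Ut sumN).
by move=> t0; rewrite t0 ltxx in tau0.
Qed.
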